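(* Let $G$ be a finite connected graph, let $t>0$, and let $X$ be an optimal function for $G$ (with respect to $t$). If $u\in V(G)$ satisfies $X(u)<\mathbb{E}(X)$, then $$\nu_X-\big(X(u)-\mathbb{E}(X)\big)=d(u,\mathbb{O}(X)).$$ In particular, if $X$ is normalized so that $\mathbb{E}(X)=0$ and $X(u)<0$, then $\nu_X-X(u)=d(u,\mathbb{O}(X))$.
   Context: A function $X:V(G)\to\mathbb{R}$ is Lipschitz if $|X(u)-X(v)|\le d(u,v)$ for all $u,v$, where $d$ is the graph distance; it is treated as a random variable by placing the uniform distribution on $V(G)$. The log-moment function of $X$ is $L_X(t)=\ln \mathbb{E}\big(e^{t(X-\mathbb{E}X)}\big)$, and $L_G(t)=\max_X L_X(t)$, the maximum being over Lipschitz functions $X$ on $V(G)$. For fixed $t>0$, a Lipschitz function $X$ is optimal if $L_X(t)=L_G(t)$. $\mathbb{O}(X)=\{v\in V(G): -0.5<X(v)-\mathbb{E}(X)\le 0.5\}$, and $\nu_X=X(w)-\mathbb{E}(X)$ for a vertex $w\in\mathbb{O}(X)$. $d(u,\mathbb{O}(X))$ is the graph distance from $u$ to the set $\mathbb{O}(X)$. *)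

(* Defs.v *)
From HB Require Import structures.
From mathcomp Require Import all_boot all_order all_algebra.
From mathcomp Require Import boolp classical_sets reals sequences exp.

Set Implicit Arguments.
Unset Strict Implicit.
Unset Printing Implicit Defensive.

Import Order.TTheory GRing.Theory Num.Theory.
Local Open Scope ring_scope.

(* A finite simple graph is a symmetric irreflexive [e : rel V] on a finType. *)

Section GraphDistance.
Variables (V : finType) (e : rel V).

Definition has_walk (n : nat) (u v : V) : bool :=
  [exists p : n.-tuple V, path e u p && (last u p == v)].

(* A shortest walk repeats no vertex, so lengths below #|V| suffice;
   the default value #|V| is taken only when v is not reachable from u. *)
Definition gdist (u v : V) : nat :=
  \big[minn/#|V|]_(n < #|V| | has_walk n u v) n.

(* The default value #|V| is taken only when no vertex of A is reachable. *)
Definition gdist_set (u : V) (A : {set V}) : nat :=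
  \big[minn/#|V|]_(w in A) gdist u w.

End GraphDistance.

Section LogMoment.
Variables (R : realType) (V : finType).
Implicit Types (X : V -> R) (t : R).

Definition mean X : R := (\sum_v X v) / #|V|%:R.

Definition graph_lipschitz (e : rel V) X : Prop :=
  forall u v, `|X u - X v| <= (gdist e u v)%:R.

Definition log_moment X t : R :=
  ln (mean (fun v => expR (t * (X v - mean X)))).

(* On a connected graph, [log_moment] is bounded on Lipschitz functions and,
   being continuous in X and invariant under adding constants to X, attains
   its supremum: [sup] is then the maximum. *)
Definition graph_log_moment (e : rel V) t : R :=
  sup [set log_moment X t | X in graph_lipschitz e]%classic.

Definition optimal (e : rel V) t X : Prop :=
  graph_lipschitz e X /\ log_moment X t = graph_log_moment e t.

Definition midset X : {set V} :=
  [set v | - (1 / 2) < X v - mean X <= 1 / 2].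

Definition nu X : R :=
  if [pick w in midset X] is Some w then X w - mean X else 0.

(* There is a vertex from which to read off [nu X], and its choice is
   irrelevant. *)
Definition nu_well_defined X : Prop :=
  (exists w, w \in midset X) /\
  (forall w, w \in midset X -> nu X = X w - mean X).

End LogMoment.

(* Main.v *)
(** Optimality is used through [expR (a + b) >= expR a * (1 + b)]: no
    nonconstant perturbation [D] with nonnegative first-order effect on the
    moment of an optimal [X] can leave [X + D] Lipschitz.
    Moving the class of the vertices whose value is congruent to [X w] modulo 1
    by a small amount, up or down, is Lipschitz, and one of the two directions
    has nonnegative effect; so that class is the whole graph, and [midset X],
    whose values lie in a half-open interval of length 1, carries a single
    value. Lowering [X] by 1 at a single vertex below the mean has nonnegative
    effect by Jensen, hence is not Lipschitz: such a vertex has a neighbour with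
    value exactly 1 higher. Climbing along such neighbours reaches [midset X] in
    as few steps as the Lipschitz condition permits. *)

Require Import Defs.
From HB Require Import structures.
From mathcomp Require Import all_boot all_order all_algebra.
From mathcomp Require Import boolp classical_sets reals sequences exp.
From mathcomp Require Import ring lra.

Set Implicit Arguments.
Unset Strict Implicit.
Unset Printing Implicit Defensive.

Import Order.TTheory GRing.Theory Num.Theory.
Local Open Scope ring_scope.

(** * Walks and graph distance *)

Lemma has_walkP (V : finType) (e : rel V) (n : nat) (u v : V) :
  reflect (exists p, [/\ size p = n, path e u p & last u p = v])
          (has_walk e n u v).
Proof.
apply: (iffP existsP) => [[p /andP[pp /eqP lp]]|[p [<- pp lp]]].
  by exists p; rewrite size_tuple.
by exists (in_tuple p); rewrite pp lp eqxx.
Qed.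

Lemma has_walkS (V : finType) (e : rel V) (n : nat) (u v w : V) :
  e u v -> has_walk e n v w -> has_walk e n.+1 u w.
Proof.
move=> euv /has_walkP[p [sp pp lp]]; apply/has_walkP.
by exists (v :: p); rewrite /= sp euv.
Qed.

Lemma gdist_le_card (V : finType) (e : rel V) (u v : V) :
  (gdist e u v <= #|V|)%N.
Proof. by rewrite /gdist -minEnat -leEnat bigmin_le_id. Qed.

Lemma gdist_walk_le (V : finType) (e : rel V) (n : nat) (u v : V) :
  has_walk e n u v -> (gdist e u v <= n)%N.
Proof.
move=> wn; case: (ltnP n #|V|) => hn; last exact: leq_trans (gdist_le_card _ _ _) hn.
rewrite /gdist -minEnat.
exact: (@bigmin_le_cond _ _ _ #|V| (Ordinal hn) _ (fun i : 'I__ => i : nat)).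
Qed.

(** A walk with repetitions removed has length below [#|V|], so the default value of the minimum is
    ruled out. *)
Lemma gdist_walk (V : finType) (e : rel V) (u v : V) :
  connect e u v -> has_walk e (gdist e u v) u v.
Proof.
move=> /connectP[p0 /shortenP[p pp up _] lp].
have wp : has_walk e (size p) u v by apply/has_walkP; exists p.
have szp : (size p < #|V|)%N by rewrite -[_.+1]/(size (u :: p)) -(card_uniqP up) max_card.
have : (gdist e u v = #|V|) \/ has_walk e (gdist e u v) u v.
  rewrite {1 2}/gdist; elim/big_ind: _ => [||i wi]; [by left| |by right].
  by move=> x y hx hy; rewrite /minn; case: ifP.
by case=> // E; move: (gdist_walk_le wp); rewrite E leqNgt szp.
Qed.

Lemma gdist_set_le (V : finType) (e : rel V) (u w : V) (A : {set V}) :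
  w \in A -> (gdist_set e u A <= gdist e u w)%N.
Proof. by move=> wA; rewrite /gdist_set -minEnat -leEnat; exact: bigmin_le_cond. Qed.

(** The default [#|V|] bounds every [gdist]; if the minimum equals it, each vertex of [A] attains
    it. *)
Lemma gdist_set_attained (V : finType) (e : rel V) (u w0 : V) (A : {set V}) :
  w0 \in A -> exists2 w, w \in A & gdist_set e u A = gdist e u w.
Proof.
move=> w0A.
have : gdist_set e u A = #|V| \/
    exists2 w, w \in A & gdist_set e u A = gdist e u w.
  rewrite /gdist_set; elim/big_ind: _ => [||w wA]; first by left.
    by move=> x y hx hy; rewrite /minn; case: ifP.
  by right; exists w.
case=> // E; exists w0 => //; apply/eqP.
by rewrite eqn_leq gdist_set_le //= E gdist_le_card.
Qed.

(** * The Lipschitz condition, checked edge by edge *)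

Lemma lipschitz_walk (R : realType) (V : finType) (e : rel V) (X : V -> R) :
  (forall u v, e u v -> `|X u - X v| <= 1) ->
  forall n u v, has_walk e n u v -> `|X u - X v| <= n%:R.
Proof.
move=> X1 n u v /has_walkP[p [<- pp <-]].
elim: p u pp => [|w p IHp] u /=; first by rewrite subrr normr0.
case/andP=> euw /IHp IH; rewrite -natr1 [leRHS]addrC.
rewrite -[X u](subrK (X w)) -addrA.
by apply: le_trans (ler_normD _ _) _; rewrite lerD ?X1.
Qed.

Lemma edge_lipschitz (R : realType) (V : finType) (e : rel V) (X : V -> R) :
  (forall u v : V, connect e u v) ->
  (forall u v, e u v -> `|X u - X v| <= 1) -> graph_lipschitz e X.
Proof.
by move=> e_conn X1 u v; apply: (lipschitz_walk X1); apply: gdist_walk.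
Qed.

Lemma lipschitz_edge (R : realType) (V : finType) (e : rel V) (X : V -> R)
    (u v : V) :
  graph_lipschitz e X -> e u v -> `|X u - X v| <= 1.
Proof.
move=> Xlip euv; apply: le_trans (Xlip u v) _; rewrite (ler_nat _ _ 1).
apply: gdist_walk_le; apply: has_walkS euv _.
by apply/has_walkP; exists [::].
Qed.

(** * Means over the vertices *)

Lemma eq_mean (R : realType) (V : finType) (X Y : V -> R) :
  X =1 Y -> mean X = mean Y.
Proof. by move=> XY; rewrite /mean (eq_bigr Y). Qed.

Lemma meanD (R : realType) (V : finType) (X Y : V -> R) :
  mean (fun v => X v + Y v) = mean X + mean Y.
Proof. by rewrite /mean big_split mulrDl. Qed.

Lemma meanZ (R : realType) (V : finType) (c : R) (X : V -> R) :
  mean (fun v => c * X v) = c * mean X.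
Proof. by rewrite /mean -mulr_sumr mulrA. Qed.

Lemma meanN (R : realType) (V : finType) (X : V -> R) :
  mean (fun v => - X v) = - mean X.
Proof. by rewrite /mean sumrN mulNr. Qed.

Lemma cardT_gt0 (R : realType) (V : finType) (u : V) : 0 < #|V|%:R :> R.
Proof. by rewrite ltr0n; apply/card_gt0P; exists u. Qed.

Lemma mean_cst (R : realType) (V : finType) (u : V) (c : R) :
  mean (fun _ : V => c) = c.
Proof.
rewrite /mean sumr_const -[_ *+ _]mulr_natr mulfK //.
by rewrite gt_eqF // (cardT_gt0 _ u).
Qed.

Lemma le_mean (R : realType) (V : finType) (X Y : V -> R) :
  (forall v, X v <= Y v) -> mean X <= mean Y.
Proof. by move=> XY; rewrite ler_wpM2r ?invr_ge0 ?ler0n ?ler_sum. Qed.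

Lemma lt_mean (R : realType) (V : finType) (X Y : V -> R) (u : V) :
  (forall v, X v <= Y v) -> X u < Y u -> mean X < mean Y.
Proof.
move=> XY XYu; rewrite ltr_pM2r ?invr_gt0 ?(cardT_gt0 _ u) //.
rewrite (bigD1 u) //= [ltRHS](bigD1 u) //=.
by rewrite ltr_leD // ler_sum.
Qed.

Lemma mean_indicator (R : realType) (V : finType) (u : V) (F : V -> R) :
  mean (fun v => F v * (v == u)%:R) = F u / #|V|%:R.
Proof.
rewrite /mean (bigD1 u) //= eqxx mulr1 big1 ?addr0 // => v /negbTE ->.
by rewrite mulr0.
Qed.

(** * The exponential moment and its first-order lower bound *)

Definition moment (R : realType) (V : finType) (X : V -> R) (t : R) : R :=
  mean (fun v => expR (t * (X v - mean X))).

(* Up to the positive factor [t], the derivative of [moment] at [X] in the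
   direction [D]. *)
Definition moment_slope (R : realType) (V : finType) (X : V -> R) (t : R)
    (D : V -> R) : R :=
  mean (fun v => expR (t * (X v - mean X)) * (D v - mean D)).

Lemma moment_slopeN (R : realType) (V : finType) (X : V -> R) (t : R)
    (D : V -> R) :
  moment_slope X t (fun v => - D v) = - moment_slope X t D.
Proof.
by rewrite /moment_slope meanN -[RHS]meanN; apply: eq_mean => v; ring.
Qed.

(** Termwise [expR (a + b) >= expR a * (1 + b)], strictly where [b] is nonzero, as it is at [u]. *)
Lemma lt_moment_tangent (R : realType) (V : finType) (X D : V -> R) (t : R)
    (u : V) :
  t != 0 -> D u != mean D ->
  moment X t + t * moment_slope X t D < moment (fun v => X v + D v) t.
Proof.
move=> t0 Du; rewrite /moment /moment_slope (meanD X D) -meanZ -meanD.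
pose a v := t * (X v - mean X); pose b v := t * (D v - mean D).
have -> : mean (fun v => expR (t * (X v + D v - (mean X + mean D)))) =
          mean (fun v => expR (a v) * expR (b v)).
  by apply: eq_mean => v; rewrite -expRD /a /b; congr expR; ring.
rewrite (@eq_mean _ _ _ (fun v => expR (a v) * (1 + b v))); last first.
  by move=> v; rewrite /a /b; ring.
apply: (@lt_mean _ _ _ _ u) => [v|].
  by rewrite ler_pM2l ?expR_gt0 ?expR_ge1Dx.
by rewrite ltr_pM2l ?expR_gt0 // expR_gt1Dx // mulf_neq0 // subr_eq0.
Qed.

Lemma moment_gt0 (R : realType) (V : finType) (u : V) (X : V -> R) (t : R) :
  0 < moment X t.
Proof.
by rewrite -(mean_cst u 0); apply: (@lt_mean _ _ _ _ u) => [v|];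
  rewrite ?expR_ge0 ?expR_gt0.
Qed.

(** Jensen's inequality for [expR], from its tangent at 0: the linear term has mean zero. *)
Lemma moment_ge1 (R : realType) (V : finType) (u : V) (X : V -> R) (t : R) :
  1 <= moment X t.
Proof.
have {1}-> : 1 = mean (fun v => 1 + t * (X v - mean X)).
  by rewrite meanD meanZ meanD !(mean_cst u) subrr mulr0 addr0.
by apply: le_mean => v; apply: expR_ge1Dx.
Qed.

(** Distances are at most [#|V|], hence so are deviations from the mean. Boundedness makes [sup] a
    genuine upper bound. *)
Lemma log_moment_bounded (R : realType) (V : finType) (e : rel V) (u : V)
    (t : R) :
  0 <= t ->
  has_ubound [set log_moment X t | X in @graph_lipschitz R V e]%classic.
Proof.
move=> t0; exists (t * #|V|%:R) => _ [X Xlip <-].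
rewrite -[leRHS]expRK /log_moment ler_ln ?posrE ?expR_gt0 ?(moment_gt0 u) //.
rewrite -[leRHS](mean_cst u); apply: le_mean => v.
rewrite ler_expR ler_wpM2l // lerBlDl -lerBlDr.
rewrite -[leLHS](mean_cst u); apply: le_mean => w.
rewrite lerBlDr -lerBlDl; apply: le_trans (ler_norm _) _.
apply: le_trans (Xlip v w) _; by rewrite ler_nat gdist_le_card.
Qed.

(** * Perturbations of an optimal function *)

Lemma optimal_moment_max (R : realType) (V : finType) (e : rel V) (u : V)
    (t : R) (X Y : V -> R) :
  0 < t -> optimal e t X -> graph_lipschitz e Y -> moment Y t <= moment X t.
Proof.
move=> t0 [_ Xmax] Ylip.
rewrite -ler_ln ?posrE ?(moment_gt0 u) // [leRHS]Xmax.
apply: ub_le_sup; last by exists Y.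
exact: (log_moment_bounded e u (ltW t0)).
Qed.

Lemma optimal_ascent_cst (R : realType) (V : finType) (e : rel V) (t : R)
    (X D : V -> R) :
  0 < t -> optimal e t X -> graph_lipschitz e (fun v => X v + D v) ->
  0 <= moment_slope X t D -> forall v, D v = mean D.
Proof.
move=> t0 Xopt XDlip slope0 v; apply/eqP; apply: contraTT isT => Dv.
have := lt_moment_tangent X (lt0r_neq0 t0) Dv.
rewrite ltNge => /negP[]; apply: le_trans (optimal_moment_max v t0 Xopt XDlip) _.
by rewrite lerDl mulr_ge0 // ltW.
Qed.

(** The slope is odd in [D], so [D] or its opposite is a direction of nonnegative slope. *)
Lemma optimal_segment_cst (R : realType) (V : finType) (e : rel V) (t : R)
    (X D : V -> R) :
  0 < t -> optimal e t X -> graph_lipschitz e (fun v => X v + D v) ->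
  graph_lipschitz e (fun v => X v - D v) -> forall v, D v = mean D.
Proof.
move=> t0 Xopt XDlip XNDlip v.
have [slope0|/ltW slope0] := leP 0 (moment_slope X t D).
  exact: (optimal_ascent_cst t0 Xopt XDlip slope0).
rewrite -oppr_ge0 -moment_slopeN in slope0.
by apply: oppr_inj; rewrite (optimal_ascent_cst t0 Xopt XNDlip slope0) meanN.
Qed.

(** * Values of an optimal function agree modulo 1 *)

Lemma optimal_int_diff (R : realType) (V : finType) (e : rel V)
    (e_conn : forall u v : V, connect e u v) (t : R) (X : V -> R) :
  0 < t -> optimal e t X -> forall u v, X u - X v \is a Num.int.
Proof.
move=> t0 Xopt u w; have [Xlip _] := Xopt.
(* The least slack among pairs differing by less than 1: a shift this small cannot push such a pair
   beyond 1. *)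
pose eps := \big[Num.min/1]_(p : V * V | `|X p.1 - X p.2| < 1)
  (1 - `|X p.1 - X p.2|).
have eps_gt0 : 0 < eps.
  by rewrite /eps; elim/big_ind: _ => // [x y|p]; rewrite ?lt_min ?subr_gt0 // => -> ->.
have eps_le x y : `|X x - X y| < 1 -> eps <= 1 - `|X x - X y|.
  exact: (@bigmin_le_cond _ _ _ 1 (x, y) _ (fun p : V * V => 1 - `|X p.1 - X p.2|)).
pose D v : R := eps * (X v - X w \is a Num.int)%:R.
have Dlip (c : R) : `|c| = 1 -> graph_lipschitz e (fun v => X v + c * D v).
  move=> c1; apply: edge_lipschitz => // x y exy.
  have Xxy := lipschitz_edge Xlip exy.
  (* Endpoints both in or both out of the class move together; otherwise their difference is not an
     integer, so the edge has slack. *)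
  have [Dxy|neqD] := eqVneq (X x - X w \is a Num.int) (X y - X w \is a Num.int).
    by rewrite /D Dxy opprD addrACA subrr addr0.
  have Xxy1 : `|X x - X y| < 1.
    rewrite lt_neqAle Xxy andbT; apply: contra neqD => /eqP Xxy1.
    have int_xy : X x - X y \is a Num.int.
      by move/eqP: Xxy1; rewrite eqr_norml => /andP[/orP[]/eqP-> _];
        rewrite ?rpredN rpred1.
    have -> : X x - X w = (X x - X y) + (X y - X w) by ring.
    by rewrite rpredDl.
  have -> : X x + c * D x - (X y + c * D y) = (X x - X y) + c * (D x - D y).
    by ring.
  apply: le_trans (ler_normD _ _) _; rewrite normrM c1 mul1r -lerBrDl.
  apply: le_trans (eps_le x y Xxy1).
  rewrite /D -mulrBr normrM gtr0_norm // ger_pMr //.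
  by case: (_ \is a _); case: (_ \is a _);
    rewrite /= ?subrr ?subr0 ?sub0r ?normrN ?normr0 ?normr1.
have Dcst : forall v, D v = mean D.
  apply: (optimal_segment_cst t0 Xopt).
    by have := Dlip 1 (normr1 _); congr graph_lipschitz; apply/funext => v; ring.
  have := Dlip (-1); rewrite normrN normr1 => /(_ erefl).
  by congr graph_lipschitz; apply/funext => v; ring.
(* [D w] is [eps], which is nonzero, so [u] belongs to the class of [w]. *)
have : D u = D w by rewrite !Dcst.
rewrite /D subrr rpred0 => /(mulfI (lt0r_neq0 eps_gt0))/eqP.
by rewrite eqr_nat eqb1.
Qed.

(** * Climbing from below the mean to [midset X] *)

Lemma optimal_up_neighbour (R : realType) (V : finType) (e : rel V)
    (e_sym : symmetric e) (e_irr : irreflexive e)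
    (e_conn : forall u v : V, connect e u v) (t : R) (X : V -> R) (u : V) :
  0 < t -> optimal e t X -> X u < mean X ->
  exists2 w, e u w & X w = X u + 1.
Proof.
move=> t0 Xopt Xu; have [Xlip _] := Xopt.
have [/existsP[w /andP[euw /eqP Xw]]|] :=
  boolP [exists w, e u w && (X w == X u + 1)]; first by exists w.
rewrite negb_exists => /forallP noup.
(* A neighbour above [X u] would exceed it by a positive integer at most 1, that is, by exactly
   1. *)
have nbr_le w : e u w -> X w <= X u /\ X u - X w <= 1.
  move=> euw; have := lipschitz_edge Xlip euw; rewrite ler_norml => /andP[lo hi].
  split=> //; rewrite leNgt; apply: contra (noup w) => Xuw.
  rewrite euw /= -subr_eq0.
  apply: contraTT Xuw => neq; rewrite -leNgt.
  have wu1 : X w - (X u + 1) \is a Num.int.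
    by rewrite opprD addrA rpredB ?rpred1 // (optimal_int_diff e_conn t0 Xopt).
  have := norm_intr_ge1 wu1 neq; rewrite ler0_norm; lra.
pose D v : R := -1 * (v == u)%:R.
have XDlip : graph_lipschitz e (fun v => X v + D v).
  apply: edge_lipschitz => // x y exy; have Xxy := lipschitz_edge Xlip exy.
  rewrite /D; have [xu|xu] := eqVneq x u; have [yu|yu] := eqVneq y u;
    rewrite ?mulr1 ?mulr0.
  - by move: exy; rewrite xu yu e_irr.
  - have := nbr_le y; rewrite -xu => /(_ exy) [h1 h2].
    by rewrite ler_norml; apply/andP; split; lra.
  - have := nbr_le x; rewrite -yu e_sym => /(_ exy) [h1 h2].
    by rewrite ler_norml; apply/andP; split; lra.
  - by rewrite !addr0.
(* Up to the factor [1 / #|V|], the slope is the moment, at least 1, minus the term at [u], at most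
   1 below the mean. *)
have slope0 : 0 <= moment_slope X t D.
  have meanD1 : mean D = -1 / #|V|%:R by rewrite (mean_indicator u (fun _ => -1)).
  have -> : moment_slope X t D =
      (moment X t - expR (t * (X u - mean X))) / #|V|%:R.
    rewrite /moment_slope meanD1.
    rewrite (@eq_mean _ _ _ (fun v => -1 * (expR (t * (X v - mean X)) * (v == u)%:R)
        + #|V|%:R^-1 * expR (t * (X v - mean X)))); last first.
      by move=> v; rewrite /D; ring.
    by rewrite meanD !meanZ mean_indicator /moment; ring.
  rewrite divr_ge0 ?ler0n // subr_ge0.
  apply: le_trans (moment_ge1 u X t).
  by rewrite -expR0 ler_expR pmulr_rle0 // subr_le0 ltW.
(* A constant [D] leaves [u] as the only vertex, and then [X u] would equal the mean. *)
have allu v : v = u.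
  have : D v = D u by rewrite !(optimal_ascent_cst t0 Xopt XDlip slope0).
  rewrite /D eqxx => /(mulfI _)/eqP; rewrite eqr_nat eqb1.
  by move=> /(_ _)/eqP; apply; rewrite oppr_eq0 oner_eq0.
by move: Xu; rewrite (@eq_mean _ _ X (fun=> X u)) ?(mean_cst u) ?ltxx // => v; rewrite (allu v).
Qed.

(** Induction on the number of vertices with value above [X u]: stepping to an upper neighbour [w]
    removes [w] from the count. *)
Lemma optimal_climb (R : realType) (V : finType) (e : rel V)
    (e_sym : symmetric e) (e_irr : irreflexive e)
    (e_conn : forall u v : V, connect e u v) (t : R) (X : V -> R) (u : V) :
  0 < t -> optimal e t X -> X u < mean X ->
  exists k, exists2 w, w \in midset X & has_walk e k u w /\ X w = X u + k%:R.
Proof.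
move=> t0 Xopt.
have [n] := ubnP #|[set v | X u < X v]|; elim: n u => // n IHn u len Xu.
have walk0 v : has_walk e 0 v v by apply/has_walkP; exists [::].
have [umid|unmid] := boolP (u \in midset X).
  by exists 0%N, u => //; rewrite addr0.
have [w euw Xw] := optimal_up_neighbour e_sym e_irr e_conn t0 Xopt Xu.
have Xulow : X u <= mean X - 1 / 2.
  rewrite leNgt; apply: contra unmid => h.
  by rewrite inE; apply/andP; split; lra.
(* From at most [mean X - 1 / 2], a step of 1 cannot overshoot the closed upper end of
   [midset X]. *)
have [wlow|whigh] := ltP (X w) (mean X); last first.
  exists 1%N, w; last by split=> //; apply: has_walkS euw _.
  by rewrite inE; apply/andP; split; lra.
have [|k [v vmid [wk Xv]]] := IHn w _ wlow.
  rewrite -ltnS; apply: leq_trans len; rewrite ltnS.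
  apply: proper_card; apply/properP; split.
    by apply/fintype.subsetP => x; rewrite !inE Xw => h; lra.
  by exists w; rewrite !inE ?ltxx // Xw; lra.
exists k.+1, v => //; split; first exact: has_walkS euw wk.
by rewrite Xv Xw -natr1 -addrA [1 + _]addrC.
Qed.

(** * The value [nu X] and the distance formula *)

Lemma optimal_nu_well_defined (R : realType) (V : finType) (e : rel V)
    (e_sym : symmetric e) (e_irr : irreflexive e)
    (e_conn : forall u v : V, connect e u v) (t : R) (X : V -> R) (u : V) :
  0 < t -> optimal e t X -> nu_well_defined X.
Proof.
move=> t0 Xopt; split.
  have [/existsP[v Xv]|] := boolP [exists v, X v < mean X].
    have [k [w wmid _]] := optimal_climb e_sym e_irr e_conn t0 Xopt Xv.
    by exists w.
  (* With no value below the mean, a value above it would raise the mean; so [X u] is the mean. *)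
  rewrite negb_exists => /forallP Xge; exists u; rewrite inE.
  have -> : X u = mean X; last by apply/andP; split; lra.
  apply/eqP; rewrite eq_le leNgt [_ <= X u]leNgt Xge andbT; apply/negP => Xu.
  have : mean (fun _ : V => mean X) < mean X.
    by apply: lt_mean Xu => v; rewrite leNgt Xge.
  by rewrite (mean_cst u) ltxx.
move=> w wmid; rewrite /nu; case: pickP => [w' w'mid|/(_ w)]; last by rewrite wmid.
(* Two values in a half-open unit interval that differ by an integer coincide. *)
congr (_ - _); apply/eqP; rewrite -subr_eq0; apply: contraTT isT => neq.
have := norm_intr_ge1 (optimal_int_diff e_conn t0 Xopt w' w) neq.
move: wmid w'mid; rewrite !inE => /andP[h1 h2] /andP[h3 h4].
by rewrite leNgt ltr_norml => /negP[]; apply/andP; split; lra.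
Qed.

Theorem corollary2p15 (R : realType) (V : finType) (e : rel V)
    (e_sym : symmetric e) (e_irr : irreflexive e)
    (e_conn : forall u v : V, connect e u v)
    (t : R) (t_gt0 : 0 < t)
    (X : V -> R) (X_opt : optimal e t X)
    (u : V) :
  [/\ nu_well_defined X,
      X u < mean X ->
        nu X - (X u - mean X) = (gdist_set e u (midset X))%:R
    & mean X = 0 -> X u < 0 ->
        nu X - X u = (gdist_set e u (midset X))%:R].
Proof.
have [mid_ex nuE] := optimal_nu_well_defined e_sym e_irr e_conn u t_gt0 X_opt.
have main : X u < mean X ->
    nu X - (X u - mean X) = (gdist_set e u (midset X))%:R.
  (* The Lipschitz bound at a nearest vertex of [midset X] gives one inequality; the climb, a walk
     of length [k] gaining exactly [k], gives the other. *)
  move=> Xu; apply/eqP; rewrite eq_le; apply/andP; split.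
    have [w0 w0mid] := mid_ex.
    have [w wmid ->] := gdist_set_attained e u w0mid.
    have [Xlip _] := X_opt; rewrite (nuE w wmid) opprB addrA subrK.
    by apply: le_trans (Xlip u w); rewrite distrC ler_norm.
  have [k [w wmid [walk Xw]]] := optimal_climb e_sym e_irr e_conn t_gt0 X_opt Xu.
  rewrite (nuE w wmid) Xw.
  have -> : X u + k%:R - mean X - (X u - mean X) = k%:R by ring.
  by rewrite ler_nat (leq_trans (gdist_set_le e u wmid)) // gdist_walk_le.
split=> // mean0; rewrite -mean0 => /main <-.
by rewrite mean0 subr0.
Qed.
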